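(* Let $g \geq 1$ and let $$\pi = \pi_1(\Sigma_g) = \left\langle x_1,\ldots,x_{2g} \mid [x_1,x_2]\cdots[x_{2g-1},x_{2g}] = 1\right\rangle.$$ Then the commutator subgroup $[\pi,\pi]$ is freely generated by the set $$\left\{ [x_i,x_j]^{x_i^{k_i} x_{i+1}^{k_{i+1}} \cdots x_{2g}^{k_{2g}}} \;\middle|\; 1 \leq i < j \leq 2g,\ (i,j) \neq (1,2),\ \text{and } k_i,k_{i+1},\ldots,k_{2g} \in \mathbb{Z} \right\}.$$
   Context: $\Sigma_g$ is a closed oriented surface of genus $g$. For elements $x,y$ of a group, $[x,y] = x^{-1}y^{-1}xy$ and $x^y = y^{-1}xy$. *)

(* Defs.v *)
From HB Require Import structures.
From mathcomp Require Import all_boot all_order all_algebra.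
From mathcomp Require Import boolp classical_sets functions.

Set Implicit Arguments.
Unset Strict Implicit.
Unset Printing Implicit Defensive.

Local Open Scope classical_set_scope.
Local Open Scope group_scope.
Local Open Scope quotient_scope.

(* A letter (t, false) stands for the generator t and (t, true) for its
   inverse. *)
Definition word (T : Type) := seq (T * bool).

Inductive word_eq (T : Type) : word T -> word T -> Prop :=
| word_eq_refl u : word_eq u u
| word_eq_sym u v : word_eq u v -> word_eq v u
| word_eq_trans v u w : word_eq u v -> word_eq v w -> word_eq u w
| word_eq_cancel u t b v : word_eq (u ++ [:: (t, b), (t, ~~ b) & v]) (u ++ v).

Definition inv_word (T : Type) (w : word T) : word T :=
  rev [seq (a.1, ~~ a.2) | a <- w].

Section FreeGroup.
Variable T : choiceType.

Definition word_eqb (u v : word T) : bool := `[< word_eq u v >].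

Fact word_eqb_refl : reflexive word_eqb.
Proof. by move=> u; apply/asboolP/word_eq_refl. Qed.

Fact word_eqb_sym : symmetric word_eqb.
Proof. by move=> u v; apply/asboolP/asboolP; apply: word_eq_sym. Qed.

Fact word_eqb_trans : transitive word_eqb.
Proof.
by move=> v u w /asboolP uv /asboolP vw; apply/asboolP/(word_eq_trans uv vw).
Qed.

Canonical word_equiv := EquivRel word_eqb word_eqb_refl word_eqb_sym word_eqb_trans.

Definition free_group := {eq_quot word_equiv}.

HB.instance Definition _ := Choice.on free_group.
HB.instance Definition _ := EqQuotient.on free_group.

Lemma free_eqP (u v : word T) :
  \pi_free_group u = \pi_free_group v <-> word_eq u v.
Proof.
by split=> [/eqmodP/asboolP | uv]; last by apply/eqmodP/asboolP.
Qed.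

Lemma word_eq_repr (w : word T) : word_eq (repr (\pi_free_group w)) w.
Proof. by apply/free_eqP; rewrite reprK. Qed.

Lemma word_eq_catl (p u v : word T) : word_eq u v -> word_eq (p ++ u) (p ++ v).
Proof.
elim=> [w|? ? _|? ? ? _ IH1 _ IH2|? ? ? ?]; rewrite ?[p ++ (_ ++ _)]catA.
- exact: word_eq_refl.
- exact: word_eq_sym.
- exact: word_eq_trans IH1 IH2.
- exact: word_eq_cancel.
Qed.

Lemma word_eq_catr (p u v : word T) : word_eq u v -> word_eq (u ++ p) (v ++ p).
Proof.
elim=> [w|? ? _|? ? ? _ IH1 _ IH2|? ? ? ?]; rewrite -?[(_ ++ _) ++ p]catA.
- exact: word_eq_refl.
- exact: word_eq_sym.
- exact: word_eq_trans IH1 IH2.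
- exact: word_eq_cancel.
Qed.

Lemma inv_word_cat (u v : word T) : inv_word (u ++ v) = inv_word v ++ inv_word u.
Proof. by rewrite /inv_word map_cat rev_cat. Qed.

Lemma inv_wordK : involutive (@inv_word T).
Proof.
move=> u; rewrite /inv_word map_rev revK -map_comp.
by rewrite -[RHS]map_id; apply: eq_map => -[t b] /=; rewrite negbK.
Qed.

Lemma word_eq_inv (u v : word T) : word_eq u v -> word_eq (inv_word u) (inv_word v).
Proof.
elim=> [w|? ? _|? ? ? _ IH1 _ IH2|a t b c].
- exact: word_eq_refl.
- exact: word_eq_sym.
- exact: word_eq_trans IH1 IH2.
- rewrite -[[:: _, _ & c]]/([:: (t, b); (t, ~~ b)] ++ c) !inv_word_cat -catA.
  by rewrite {2}/inv_word /= negbK; apply: word_eq_cancel.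
Qed.

Lemma word_eq_mulV (u : word T) : word_eq (inv_word u ++ u) [::].
Proof.
elim: u => [|[t b] u IH]; first exact: word_eq_refl.
rewrite -cat1s inv_word_cat -catA /=.
by apply: word_eq_trans IH; rewrite -{2}[b]negbK; apply: word_eq_cancel.
Qed.

Definition free_one : free_group := \pi_free_group [::].
Definition free_mul (x y : free_group) : free_group :=
  \pi_free_group (repr x ++ repr y).
Definition free_inv (x : free_group) : free_group :=
  \pi_free_group (inv_word (repr x)).

Lemma free_mulE (u v : word T) :
  free_mul (\pi_free_group u) (\pi_free_group v) = \pi_free_group (u ++ v).
Proof.
apply/free_eqP; apply: word_eq_trans (word_eq_catr v (word_eq_repr u)).
exact: word_eq_catl (word_eq_repr v).
Qed.

Lemma free_invE (u : word T) :
  free_inv (\pi_free_group u) = \pi_free_group (inv_word u).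
Proof. by apply/free_eqP/word_eq_inv/word_eq_repr. Qed.

Fact free_mulA : associative free_mul.
Proof.
move=> x y z; rewrite -[x]reprK -[y]reprK -[z]reprK.
set u := repr x; set v := repr y; set w := repr z.
by rewrite (free_mulE v w) (free_mulE u v) !free_mulE catA.
Qed.

Fact free_mul1 : left_id free_one free_mul.
Proof. by move=> x; rewrite -[x]reprK /free_one free_mulE. Qed.

Fact free_mulr1 : right_id free_one free_mul.
Proof. by move=> x; rewrite -[x]reprK /free_one free_mulE cats0. Qed.

Fact free_mulV : left_inverse free_one free_inv free_mul.
Proof.
move=> x; rewrite -[x]reprK free_invE free_mulE.
exact/free_eqP/word_eq_mulV.
Qed.

Fact free_mulrV : right_inverse free_one free_inv free_mul.
Proof.
move=> x; rewrite -[x]reprK free_invE free_mulE; apply/free_eqP.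
by rewrite -{1}[repr x]inv_wordK; apply: word_eq_mulV.
Qed.

HB.instance Definition _ := isGroup.Build free_group
  free_mulA free_mul1 free_mulr1 free_mulV free_mulrV.

Definition free_gen (t : T) : free_group := \pi_free_group [:: (t, false)].

End FreeGroup.

Section FreeLift.
Variables (T : choiceType) (G : groupType) (f : T -> G).

Definition word_eval (w : word T) : G :=
  \prod_(a <- w) (if a.2 then (f a.1)^-1 else f a.1).

Lemma word_eval_eq (u v : word T) : word_eq u v -> word_eval u = word_eval v.
Proof.
elim=> [//|? ? _ -> //|? ? ? _ -> _ -> //|a t b c].
rewrite /word_eval !big_cat !big_cons /=; congr (_ * _).
by case: b => /=; rewrite ?mulKg ?mulVKg.
Qed.

(* The homomorphism from the free group on T to G that extends f. *)
Definition free_lift (x : free_group T) : G := word_eval (repr x).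

Lemma free_liftE (w : word T) : free_lift (\pi_(free_group T) w) = word_eval w.
Proof. exact/word_eval_eq/word_eq_repr. Qed.

Fact free_liftM : {morph free_lift : x y / x * y}.
Proof.
move=> x y; rewrite -[x]reprK -[y]reprK.
rewrite [X in free_lift X]free_mulE !free_liftE.
by rewrite /word_eval big_cat.
Qed.

HB.instance Definition _ :=
  isMultiplicative.Build (free_group T) G free_lift free_liftM.

Fact free_lift1 : free_lift 1 = 1.
Proof. by rewrite [LHS]free_liftE /word_eval big_nil. Qed.

HB.instance Definition _ :=
  Multiplicative_isUMagmaMorphism.Build (free_group T) G free_lift free_lift1.

Lemma free_lift_gen (t : T) : free_lift (free_gen t) = f t.
Proof. by rewrite free_liftE /word_eval big_seq1. Qed.

End FreeLift.

Section Subgroups.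
Variable G : groupType.

Definition subgroup (H : set G) : Prop :=
  H 1 /\ forall x y, H x -> H y -> H (x / y).

Definition normal_subgroup (N : set G) : Prop :=
  subgroup N /\ forall x y, N x -> N (x ^ y).

Definition normal_closure (R : set G) : set G := smallest normal_subgroup R.

Definition commutator_subgroup : set G :=
  smallest subgroup [set z | exists x y : G, z = [~ x, y]].

(* H is a subgroup freely generated by its subset S: the homomorphism from the
   free group on S to G that extends the inclusion of S is injective with
   image H. *)
Definition freely_generated (H S : set G) : Prop :=
  injective (free_lift (val : set_type S -> G)) /\
  range (free_lift (val : set_type S -> G)) = H.

Definition expgz (x : G) (k : int) : G :=
  match k with Posz n => x ^+ n | Negz n => x ^- n.+1 end.

End Subgroups.

Arguments commutator_subgroup G : clear implicits.

Section QuotientByRelators.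
Variables (G : groupType) (R : set G).

Lemma normal_closure_normal : normal_subgroup (normal_closure R).
Proof.
split; [split=> [N [[[]]] // | x y Rx Ry N NR] | move=> x y Rx N NR].
- by case: (NR) => -[[_ ND] _] _; apply: ND; [apply: Rx | apply: Ry].
- by case: (NR) => -[_ NJ] _; apply: NJ; apply: Rx.
Qed.

Let N := normal_closure R.

Lemma ncl1 : N 1. Proof. by case: normal_closure_normal => -[]. Qed.

Lemma nclD x y : N x -> N y -> N (x / y).
Proof. by case: normal_closure_normal => -[_ h] _; apply: h. Qed.

Lemma nclJ x y : N x -> N (x ^ y).
Proof. by case: normal_closure_normal => _; apply. Qed.

Lemma nclV x : N x -> N x^-1.
Proof. by rewrite -[x^-1]mul1g; exact: nclD ncl1. Qed.

Lemma nclM x y : N x -> N y -> N (x * y).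
Proof. by move=> Nx /nclV Ny; rewrite -[y]invgK; apply: nclD. Qed.

Definition ncl_eqb (x y : G) : bool := `[< normal_closure R (x^-1 * y) >].

Fact ncl_eqb_refl : reflexive ncl_eqb.
Proof. by move=> x; apply/asboolP; rewrite mulVg; apply: ncl1. Qed.

Fact ncl_eqb_sym : symmetric ncl_eqb.
Proof. by move=> x y; apply/asboolP/asboolP => /nclV; rewrite invgM invgK. Qed.

Fact ncl_eqb_trans : transitive ncl_eqb.
Proof.
move=> y x z /asboolP xy /asboolP yz; apply/asboolP.
by have := nclM xy yz; rewrite -mulgA mulVKg.
Qed.

Canonical ncl_equiv := EquivRel ncl_eqb ncl_eqb_refl ncl_eqb_sym ncl_eqb_trans.

(* The quotient of G by the normal closure of R. *)
Definition ncl_quotient := {eq_quot ncl_equiv}.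

HB.instance Definition _ := Choice.on ncl_quotient.
HB.instance Definition _ := EqQuotient.on ncl_quotient.

Definition ncl_proj (x : G) : ncl_quotient := \pi_ncl_quotient x.

Lemma ncl_projP (x y : G) : ncl_proj x = ncl_proj y <-> N (x^-1 * y).
Proof.
by split=> [/eqmodP/asboolP | xy]; last by apply/eqmodP/asboolP.
Qed.

Lemma ncl_projK (x : ncl_quotient) : ncl_proj (repr x) = x.
Proof. exact: reprK. Qed.

Definition nclq_one : ncl_quotient := ncl_proj 1.
Definition nclq_mul (x y : ncl_quotient) : ncl_quotient :=
  ncl_proj (repr x * repr y).
Definition nclq_inv (x : ncl_quotient) : ncl_quotient := ncl_proj (repr x)^-1.

Lemma nclq_mulE (x y : G) :
  nclq_mul (ncl_proj x) (ncl_proj y) = ncl_proj (x * y).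
Proof.
apply/ncl_projP; set x' := repr _; set y' := repr _.
have Nx : N (x'^-1 * x) by apply/ncl_projP/ncl_projK.
have Ny : N (y'^-1 * y) by apply/ncl_projP/ncl_projK.
have := nclM (nclJ y' Nx) Ny.
by rewrite conjgE invgM !mulgA mulgK.
Qed.

Lemma nclq_invE (x : G) : nclq_inv (ncl_proj x) = ncl_proj x^-1.
Proof.
apply/ncl_projP; set x' := repr _.
have /nclV/(nclJ x'^-1) : N (x'^-1 * x) by apply/ncl_projP/ncl_projK.
by rewrite conjgE !invgM !invgK -!mulgA mulgV mulg1.
Qed.

Fact nclq_mulA : associative nclq_mul.
Proof.
move=> x y z; rewrite -[x]ncl_projK -[y]ncl_projK -[z]ncl_projK.
set u := repr x; set v := repr y; set w := repr z.
by rewrite (nclq_mulE v w) (nclq_mulE u v) !nclq_mulE mulgA.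
Qed.

Fact nclq_mul1 : left_id nclq_one nclq_mul.
Proof. by move=> x; rewrite -[x]ncl_projK nclq_mulE mul1g. Qed.

Fact nclq_mulr1 : right_id nclq_one nclq_mul.
Proof. by move=> x; rewrite -[x]ncl_projK nclq_mulE mulg1. Qed.

Fact nclq_mulV : left_inverse nclq_one nclq_inv nclq_mul.
Proof. by move=> x; rewrite -[x]ncl_projK nclq_invE nclq_mulE mulVg. Qed.

Fact nclq_mulrV : right_inverse nclq_one nclq_inv nclq_mul.
Proof. by move=> x; rewrite -[x]ncl_projK nclq_invE nclq_mulE mulgV. Qed.

HB.instance Definition _ := isGroup.Build ncl_quotient
  nclq_mulA nclq_mul1 nclq_mulr1 nclq_mulV nclq_mulrV.

Fact ncl_projM : {morph ncl_proj : x y / x * y}.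
Proof. by move=> x y; rewrite -nclq_mulE. Qed.

HB.instance Definition _ :=
  isMultiplicative.Build G ncl_quotient ncl_proj ncl_projM.

Fact ncl_proj1 : ncl_proj 1 = 1. Proof. by []. Qed.

HB.instance Definition _ :=
  Multiplicative_isUMagmaMorphism.Build G ncl_quotient ncl_proj ncl_proj1.

End QuotientByRelators.

(* The group with generators indexed by T and relators R. *)
Definition presented_group (T : choiceType) (R : set (free_group T)) : groupType :=
  ncl_quotient R.

Definition presented_gen (T : choiceType) (R : set (free_group T)) (t : T) :
  presented_group R := ncl_proj R (free_gen t).

Section SurfaceGroup.
Variable g : nat.

Fact even_index_subproof (k : 'I_g) : (2 * k < 2 * g)%N.
Proof. by rewrite ltn_pmul2l. Qed.

Fact odd_index_subproof (k : 'I_g) : ((2 * k).+1 < 2 * g)%N.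
Proof. by rewrite !mul2n ltn_Sdouble. Qed.

(* Generators are indexed from 0: the element written x_(i + 1) in the usual
   presentation, 1 <= i + 1 <= 2g, has index i. *)
Definition even_index (k : 'I_g) : 'I_(2 * g) := Ordinal (even_index_subproof k).
Definition odd_index (k : 'I_g) : 'I_(2 * g) := Ordinal (odd_index_subproof k).

Definition surface_relator : free_group 'I_(2 * g) :=
  \prod_(k < g) [~ free_gen (even_index k), free_gen (odd_index k)].

Definition surface_group : groupType := presented_group [set surface_relator].

Definition surface_gen (i : 'I_(2 * g)) : surface_group :=
  presented_gen [set surface_relator] i.

(* The values of k below i are irrelevant, so k ranges over all exponent
   families; the pair excluded by the third condition is (1, 2) in 1-based
   indexing. *)
Definition commutator_basis : set surface_group :=
  [set z | exists (i j : 'I_(2 * g)) (k : 'I_(2 * g) -> int),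
     [/\ (i < j)%N, (i : nat, j : nat) <> (0, 1)%N &
         z = [~ surface_gen i, surface_gen j] ^
               (\prod_(l < 2 * g | i <= l) expgz (surface_gen l) (k l))]].

End SurfaceGroup.

Arguments commutator_basis g : clear implicits.

(* Main.v *)
(** Idea.  The free abelian cover of the wedge of 2g circles is the grid Z^(2g).
    Its comb is the spanning tree whose edges in direction j are those at the
    vertices v with v_i = 0 for all i < j.  The commutator [x_i, x_j] conjugated
    by x_i^(-v_i) ... x_2g^(-v_2g) is the loop that follows the comb to v, runs
    around the (i, j)-square with upper corner v and comes back.  The two sides
    of this square in direction i lie on the comb, so the loop is the quotient of
    the loops of two consecutive edges in direction j; hence the loops of the
    edges outside the comb and those of the squares determine each other.  Edges
    in direction j >= 3 never involve (1, 2)-squares, so the surface relation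
    based at v expresses the (1, 2)-square at v through the other squares, and
    imposes nothing else on them.

    Accordingly, edges are labelled in the free group A on the stated basis, with
    trivial labels on the comb and the prescribed value around each square.  The
    relator then has trivial label at every vertex, so that reading labels is a
    homomorphism from the surface group to a twisted product of the functions
    Z^(2g) -> A with Z^(2g); on the commutator subgroup, the label of a path from
    the origin is a two-sided inverse of the map from A. *)

Require Import Defs.
From HB Require Import structures.
From mathcomp Require Import all_boot all_order all_algebra.
From mathcomp Require Import boolp classical_sets functions.
From mathcomp Require Import zify.

Set Implicit Arguments.
Unset Strict Implicit.
Unset Printing Implicit Defensive.

Import GRing.Theory.

(** * Homomorphisms out of presented groups, subgroups, ordered products *)

Section Homomorphisms.
Local Open Scope group_scope.

Lemma free_group_ind (T : choiceType) (P : free_group T -> Prop) :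
  P 1 -> (forall x y, P x -> P y -> P (x * y)) -> (forall x, P x -> P x^-1) ->
  (forall t, P (free_gen t)) -> forall x, P x.
Proof.
move=> P1 PM PV Pg x; rewrite -[x]reprK.
elim: (repr x) => [//|[t b] w IH].
rewrite -cat1s -[X in P X]free_mulE; apply: (PM) => //.
case: b; last exact: Pg.
rewrite [X in P X](_ : _ = (free_gen t)^-1); first exact: PV.
by rewrite [RHS]free_invE.
Qed.

Lemma presented_group_ind (T : choiceType) (R : set (free_group T))
    (P : presented_group R -> Prop) :
  P 1 -> (forall x y, P x -> P y -> P (x * y)) -> (forall x, P x -> P x^-1) ->
  (forall t, P (presented_gen R t)) -> forall x, P x.
Proof.
move=> P1 PM PV Pg x; rewrite -[x]ncl_projK.
elim/free_group_ind: (repr x) => [//|y z Py Pz|y Py|t]; last exact: Pg.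
- by rewrite gmulfM; apply: PM.
- by rewrite gmulfV; apply: PV.
Qed.

Lemma free_liftV (T : choiceType) (G : groupType) (f : T -> G) :
  {morph free_lift f : x / x^-1}.
Proof. exact: gmulfV. Qed.

Lemma free_lift_normal_closure (T : choiceType) (G : groupType) (f : T -> G)
    (R : set (free_group T)) :
  (forall r, R r -> free_lift f r = 1) ->
  forall x, normal_closure R x -> free_lift f x = 1.
Proof.
move=> fR x Nx; apply: (Nx [set y | free_lift f y = 1]%classic).
split; last by move=> r /fR.
split; first split; rewrite /= ?gmulf1 // => y z.
- by move=> fy fz; rewrite gmulfF /= fy fz mulgV.
- by move=> fy; rewrite gmulfJ /= fy conj1g.
Qed.

Lemma presented_lift (T : choiceType) (R : set (free_group T)) (G : groupType)
    (f : T -> G) :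
  (forall r, R r -> free_lift f r = 1) ->
  exists F : UMagmaMorphism.type (presented_group R) G,
    forall t, F (presented_gen R t) = f t.
Proof.
move=> fR; pose F (x : presented_group R) := free_lift f (repr x).
have FE x : F (ncl_proj R x) = free_lift f x.
  apply: (mulgI (F (ncl_proj R x))^-1); rewrite mulVg -gmulfV -gmulfM; symmetry.
  exact/(free_lift_normal_closure fR)/ncl_projP/ncl_projK.
have FM : {morph F : x y / x * y}.
  move=> x y; rewrite -[x]ncl_projK -[y]ncl_projK -gmulfM !FE.
  exact: gmulfM.
have F1 : F 1 = 1 by rewrite -(ncl_proj1 R) FE gmulf1.
pose m := isMultiplicative.Build _ _ F FM.
pose FF := HB.pack_for (UMagmaMorphism.type (presented_group R) G) F m
  (Multiplicative_isUMagmaMorphism.Build _ _ F F1).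
by exists FF => t; rewrite -(free_lift_gen f t) -FE.
Qed.

Variable G : groupType.
Implicit Types x y z : G.

Lemma subgroupV (H : set G) x : subgroup H -> H x -> H x^-1.
Proof. by case=> H1 HF Hx; rewrite -[x^-1]mul1g; apply: HF. Qed.

Lemma subgroupM (H : set G) x y : subgroup H -> H x -> H y -> H (x * y).
Proof.
move=> sH Hx Hy; rewrite -[y]invgK; case: (sH) => _; apply=> //.
exact: subgroupV.
Qed.

Lemma commutator_subgroup_subgroup : subgroup (commutator_subgroup G).
Proof.
split=> [H [[]] // | x y Hx Hy H [HG HR]].
by case: (HG) => _ HF; apply: HF; [apply: Hx | apply: Hy].
Qed.

Lemma expgzS x (a : int) : expgz x (a + 1)%R = x * expgz x a.
Proof.
case: a => n; first by rewrite -PoszD addn1 /= expgS.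
case: n => [|n]; first by rewrite /= expg1 mulgV.
have -> : (Negz n.+1 + 1)%R = Negz n by lia.
by rewrite /= [x ^+ n.+2]expgSr invgM mulVKg.
Qed.

Lemma prod_ord_head n (i : 'I_n) (F : 'I_n -> G) :
  (forall l : 'I_n, l < i -> F l = 1) ->
  \prod_(l < n) F l = F i * \prod_(l < n | i < l) F l.
Proof.
elim: n i F => [|n IH] i F F1; first by case: i F1.
rewrite [in RHS]big_mkcond !big_ord_recl /=.
case: (unliftP ord0 i) F1 => [j ->|->] F1 /=; rewrite mul1g.
  rewrite F1 // mul1g (IH j) => [|l lj]; last by apply: F1; rewrite /= ltnS.
  by rewrite big_mkcond.
by congr (_ * _); apply: eq_bigr.
Qed.

End Homomorphisms.

(** * The comb as a spanning tree of the grid *)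

Section CombTree.
Variable n : nat.
Local Open Scope ring_scope.

Definition unit_vec (j : 'I_n) : {ffun 'I_n -> int} := [ffun l => (l == j)%:Z].

(* The vertices carrying the edges of the comb in direction j. *)
Definition supp_above (j : nat) (v : {ffun 'I_n -> int}) : Prop :=
  forall l : 'I_n, (l < j)%N -> v l = 0.

Definition update (v : {ffun 'I_n -> int}) (i : 'I_n) (a : int) :
  {ffun 'I_n -> int} := [ffun l => if l == i then a else v l].

Lemma update_id v i : update v i (v i) = v.
Proof. by apply/ffunP => l; rewrite ffunE; case: eqP => [->|]. Qed.

Lemma updateS v i a : update v i (a + 1) = update v i a + unit_vec i.
Proof. by apply/ffunP => l; rewrite !ffunE; case: eqP => // _; rewrite addr0. Qed.

Lemma update_add_unit v i a : update (v + unit_vec i) i a = update v i a.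
Proof. by apply/ffunP => l; rewrite !ffunE; case: eqP => // _; rewrite addr0. Qed.

Lemma supp_above_add_unit (i : nat) (j : 'I_n) v :
  (i <= j)%N -> supp_above i v -> supp_above i (v + unit_vec j).
Proof.
move=> ij iv l li; rewrite !ffunE iv // add0r.
by case: eqP => // lj; move: li; rewrite lj ltnNge ij.
Qed.

(** The comb reaches every vertex: coordinates are filled in from the last one down, each by walking
    from 0 along comb edges in its own direction. *)
Lemma comb_ind (P : {ffun 'I_n -> int} -> Prop) :
  P 0 -> (forall v (j : 'I_n), supp_above j v -> (P v <-> P (v + unit_vec j))) ->
  forall v, P v.
Proof.
move=> P0 PS v.
suff H d : (d <= n)%N -> forall v, supp_above (n - d) v -> P v.
  by apply: (H n) => // l; rewrite subnn.
elim: d => [_ w hw|d IH dn w hw].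
  suff -> : w = 0 by [].
  by apply/ffunP => l; rewrite ffunE hw // subn0.
have dP : (n - d.+1 < n)%N by rewrite ltn_subrL /=; case: (n) dn.
pose i := Ordinal dP.
have wi a : supp_above i (update w i a).
  move=> l li; rewrite ffunE hw //; case: eqP => // le.
  by move: li; rewrite le ltnn.
rewrite -(update_id w i); elim/int_ind: (w i) => [|m Pm|m Pm].
- apply: IH => [|l]; first exact: ltnW.
  rewrite -subnSK // ltnS leq_eqVlt ffunE => /orP[/eqP le|li].
    by case: eqP => // ne; case: ne; apply: val_inj.
  by case: eqP => // _; apply: hw.
- by rewrite -addn1 PoszD updateS; apply/(PS _ i (wi _)).1.
- have e : - m%:Z = - m.+1%:Z + 1 by lia.
  by rewrite e updateS in Pm; apply/(PS _ i (wi _)).2.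
Qed.

End CombTree.

(** * Edge labellings with prescribed values around squares *)

Section Labels.
Variables (n : nat) (A : groupType).
Local Open Scope group_scope.
Notation V := {ffun 'I_n -> int}.

(* The value of u at a, where u 0 = 1 and u (a + 1) = u a * h (a + 1) for every
   integer a. *)
Definition int_prod (h : int -> A) (a : int) : A :=
  match a with
  | Posz m => \prod_(l < m) h l.+1
  | Negz m => \prod_(l < m.+1) (h (- l%:Z)%R)^-1
  end.

Lemma int_prodS h a : int_prod h (a + 1)%R = int_prod h a * h (a + 1)%R.
Proof.
case: a => m; first by rewrite -PoszD addn1 /= big_ord_recr.
case: m => [|m]; first by rewrite /= big_ord0 big_ord1 mulVg.
have -> : (Negz m.+1 + 1)%R = Negz m by lia.
by rewrite /= [in RHS]big_ord_recr /= mulgVK.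
Qed.

(* rho v is the label of the edge from v to v + e_j, and q i w that of the
   (i, j)-square with upper corner w. *)
Definition comb_labelling (j : 'I_n) (rho : V -> A) (q : 'I_n -> V -> A) : Prop :=
  (forall v, supp_above j v -> rho v = 1) /\
  forall (i : 'I_n) v, i < j -> supp_above i v ->
    rho (v + unit_vec i)%R = rho v * q i (v + unit_vec i + unit_vec j)%R.

(** Induction along the comb: a step in direction [i < j] crosses a square, which ties the two
    labels together; a step in direction [i >= j] stays where labels in direction [j] are
    trivial. *)
Lemma comb_labelling_unique (j : 'I_n) rho rho' q q' :
  comb_labelling j rho q -> comb_labelling j rho' q' ->
  (forall (i : 'I_n) v, i < j -> supp_above i v -> q i v = q' i v) ->
  rho =1 rho'.
Proof.
move=> [r0 rS] [r0' rS'] qq'; elim/comb_ind => [|v i iv].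
  by rewrite r0 ?r0' // => l _; rewrite ffunE.
have iiv := supp_above_add_unit (leqnn i) iv.
have [ij|ji] := ltnP i j; last first.
  have jv : supp_above j v by move=> l lj; apply: iv; apply: leq_trans ji.
  by rewrite !(r0, r0') //; apply: supp_above_add_unit.
rewrite rS // rS' // qq' //; last exact/supp_above_add_unit/iiv/ltnW.
by split=> [-> //|/mulIg].
Qed.

Definition strip_prod (j i : 'I_n) (q : 'I_n -> V -> A) (v : V) : A :=
  int_prod (fun a => q i (update v i a + unit_vec j)%R) (v i).

(* The ascending product of inverses makes the factors of the label come in
   descending order of i: coordinate i is filled in after those above it. *)
Definition comb_label (j : 'I_n) (q : 'I_n -> V -> A) (v : V) : A :=
  (\prod_(i < n | i < j) (strip_prod j i q v)^-1)^-1.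

(** When coordinate [i] grows by one, its strip gains one square. Strips of higher index do not see
    that coordinate, by the locality of [q]; those of lower index are empty. *)
Lemma comb_labelP (j : 'I_n) (q : 'I_n -> V -> A) :
  (forall (i : 'I_n) (v w : V),
    (forall l : 'I_n, i <= l -> v l = w l) -> q i v = q i w) ->
  comb_labelling j (comb_label j q) q.
Proof.
move=> qE; split=> [v jv|i v ij iv].
  rewrite /comb_label big1 ?invg1 // => i ij.
  by rewrite /strip_prod jv //= big_ord0 invg1.
pose F v (l : 'I_n) := if l < j then (strip_prod j l q v)^-1 else 1.
have F1 w : supp_above i w -> forall l : 'I_n, l < i -> F w l = 1.
  move=> iw l li; rewrite /F (ltn_trans li ij) /strip_prod iw //=.
  by rewrite big_ord0 invg1.
have LE w : comb_label j q w = (\prod_l F w l)^-1.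
  by rewrite /comb_label big_mkcond.
have iiv := supp_above_add_unit (leqnn i) iv.
rewrite !LE (prod_ord_head (F1 _ iv)) (prod_ord_head (F1 _ iiv)).
rewrite (eq_bigr (F v)) => [|l il]; last first.
  rewrite /F; case: ifP => // lj; congr _^-1; rewrite /strip_prod !ffunE.
  have -> : (l == i) = false by apply/eqP => e; rewrite e ltnn in il.
  rewrite addr0; congr (int_prod _ _); apply: funext => a.
  apply: qE => m lm; rewrite !ffunE; case: eqP => // _.
  have -> : (m == i) = false.
    by apply/eqP => e; move: (leq_trans il lm); rewrite e ltnn.
  by rewrite addr0.
rewrite !invgM /F ij !invgK -mulgA; congr (_ * _).
rewrite /strip_prod (_ : (v + unit_vec i)%R i = (v i + 1)%R); last first.
  by rewrite !ffunE eqxx.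
rewrite (_ : (fun a => q i _) = fun a => q i (update v i a + unit_vec j)%R).
  by rewrite int_prodS updateS update_id.
by apply: funext => a; rewrite update_add_unit.
Qed.

End Labels.

(** * Tree paths and the loops of edges and squares *)

Section TreePaths.
Variables (n : nat) (G : groupType) (x : 'I_n -> G).
Local Open Scope group_scope.
Notation V := {ffun 'I_n -> int}.

(** The powers [expgz (x l) (v l)] multiplied in descending order of [l], the order in which the
    comb fills coordinates; in this form the inverse is a conjugator of the stated basis. *)
Definition tree_path (v : V) : G := (\prod_(l < n) expgz (x l) (- v l)%R)^-1.

Lemma tree_path0 : tree_path 0%R = 1.
Proof. by rewrite /tree_path big1 ?invg1 // => l _; rewrite ffunE oppr0. Qed.

Lemma tree_pathS (v : V) (j : 'I_n) : supp_above j v ->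
  tree_path (v + unit_vec j)%R = tree_path v * x j.
Proof.
have E1 w : supp_above j w ->
    forall l : 'I_n, l < j -> expgz (x l) (- w l)%R = 1.
  by move=> jw l lj; rewrite jw // oppr0.
move=> jv; have jjv := supp_above_add_unit (leqnn j) jv.
rewrite /tree_path (prod_ord_head (E1 _ jv)) (prod_ord_head (E1 _ jjv)).
rewrite (eq_bigr (fun l => expgz (x l) (- v l)%R)) => [|l jl]; last first.
  rewrite !ffunE; case: eqP => [e|_]; first by rewrite e ltnn in jl.
  by rewrite addr0.
rewrite !ffunE eqxx (_ : (- v j = - (v j + 1) + 1)%R); last by lia.
by rewrite expgzS !invgM -!mulgA mulVg mulg1.
Qed.

Definition square_loop (i j : 'I_n) (v : V) : G :=
  [~ x i, x j] ^ (\prod_(l < n | i <= l) expgz (x l) (- v l)%R).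

Lemma square_loopE (i j : 'I_n) (v : V) : supp_above i v ->
  square_loop i j v = [~ x i, x j] ^ (tree_path v)^-1.
Proof.
move=> iv; rewrite /square_loop /tree_path invgK big_mkcond.
congr (_ ^ _); apply: eq_bigr => l _.
by have [//|li] := leqP; rewrite iv // oppr0.
Qed.

Definition edge_loop (j : 'I_n) (v : V) : G :=
  tree_path v * x j * (tree_path (v + unit_vec j)%R)^-1.

Lemma edge_loopP (j : 'I_n) :
  comb_labelling j (edge_loop j) (square_loop^~ j).
Proof.
split=> [v jv|i v ij iv]; first by rewrite /edge_loop tree_pathS // mulgV.
have iiv := supp_above_add_unit (leqnn i) iv.
have ijv := supp_above_add_unit (ltnW ij) iv.
rewrite square_loopE; last exact: supp_above_add_unit (ltnW ij) iiv.
rewrite /edge_loop (tree_pathS iv) addrAC (tree_pathS ijv).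
rewrite conjgE commgEl conjgE !invgM invgK -!mulgA.
by rewrite !(mulKg, mulVKg).
Qed.

End TreePaths.

Lemma gmulf_expgz (G H : groupType) (f : UMagmaMorphism.type G H) (y : G) a :
  f (expgz y a) = expgz (f y) a.
Proof. by case: a => m; rewrite /= ?gmulfXVn ?gmulfXn. Qed.

(** * The twisted product of labels and displacements *)

Section WalkGroup.
Variables (A : groupType) (V : zmodType).
Local Open Scope group_scope.

(* (f, v) stands for a word with displacement v, and f u for the label that it
   reads when it starts at u. *)
Definition walk : Type := ((V -> A) * V)%type.
HB.instance Definition _ := Choice.on walk.

Definition walk_one : walk := (fun=> 1, 0%R).
Definition walk_mul (p q : walk) : walk :=
  (fun v => p.1 v * q.1 (v + p.2)%R, (p.2 + q.2)%R).
Definition walk_inv (p : walk) : walk :=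
  (fun v => (p.1 (v - p.2)%R)^-1, (- p.2)%R).

Lemma walk_eq (p q : walk) : p.1 =1 q.1 -> p.2 = q.2 -> p = q.
Proof. by case: p q => [f v] [h w] /= /funext -> ->. Qed.

Fact walk_mulA : associative walk_mul.
Proof. by move=> p q r; apply: walk_eq => [v|] /=; rewrite ?mulgA addrA. Qed.

Fact walk_mul1 : left_id walk_one walk_mul.
Proof. by move=> p; apply: walk_eq => [v|] /=; rewrite ?mul1g (addr0, add0r). Qed.

Fact walk_mulr1 : right_id walk_one walk_mul.
Proof. by move=> p; apply: walk_eq => [v|] /=; rewrite ?mulg1 ?addr0. Qed.

Fact walk_mulV : left_inverse walk_one walk_inv walk_mul.
Proof. by move=> p; apply: walk_eq => [v|] /=; rewrite ?mulVg ?addNr. Qed.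

Fact walk_mulrV : right_inverse walk_one walk_inv walk_mul.
Proof. by move=> p; apply: walk_eq => [v|] /=; rewrite ?addrK ?mulgV ?subrr. Qed.

HB.instance Definition _ := isGroup.Build walk
  walk_mulA walk_mul1 walk_mulr1 walk_mulV walk_mulrV.

Lemma walkM1 (p q : walk) v : (p * q).1 v = p.1 v * q.1 (v + p.2)%R.
Proof. by []. Qed.

Lemma walkM2 (p q : walk) : (p * q).2 = (p.2 + q.2)%R.
Proof. by []. Qed.

Lemma walkV1 (p : walk) v : p^-1.1 v = (p.1 (v - p.2)%R)^-1.
Proof. by []. Qed.

Lemma walkV2 (p : walk) : p^-1.2 = (- p.2)%R.
Proof. by []. Qed.

Lemma walk_commg2 (p q : walk) : [~ p, q].2 = 0%R.
Proof.
have -> : [~ p, q].2 = (- p.2 + (- q.2 + (p.2 + q.2)))%R by [].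
by rewrite (addrC p.2) addKr addNr.
Qed.

Lemma walk_commg1 (p q : walk) v : [~ p, q].1 v =
  (p.1 (v - p.2)%R)^-1 * ((q.1 (v - p.2 - q.2)%R)^-1 *
    (p.1 (v - p.2 - q.2)%R * q.1 (v - q.2)%R)).
Proof.
by rewrite commgEl conjgE /= (addrAC _ (- q.2)%R p.2) subrK.
Qed.

Lemma walk_prod_pure (I : Type) (r : seq I) (F : I -> walk) v :
  (forall i, (F i).2 = 0%R) ->
  (\prod_(i <- r) F i).2 = 0%R /\
  (\prod_(i <- r) F i).1 v = \prod_(i <- r) (F i).1 v.
Proof.
move=> F2; elim: r => [|i r [IH2 IH1]]; first by rewrite !big_nil.
by rewrite !big_cons /= F2 IH2 !addr0 IH1.
Qed.

End WalkGroup.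

(** * Labels read around a square *)

Section SquareLabels.
Variable n : nat.
Local Open Scope group_scope.
Notation V := {ffun 'I_n -> int}.

(** What the commutator of letters [i] and [j] reads from [v]: it begins with the inverse letters,
    so [v] is the upper corner. *)
Definition square_label (A : groupType) (rho : 'I_n -> V -> A) (i j : 'I_n)
    (v : V) : A :=
  (rho i (v - unit_vec i)%R)^-1 *
    ((rho j (v - unit_vec i - unit_vec j)%R)^-1 *
      (rho i (v - unit_vec i - unit_vec j)%R * rho j (v - unit_vec j)%R)).

Lemma supp_above_sub_unit (i : nat) (j : 'I_n) v :
  i <= j -> supp_above i v -> supp_above i (v - unit_vec j)%R.
Proof.
move=> ij iv l li; rewrite !ffunE iv // add0r.
by case: eqP => // lj; move: li; rewrite lj ltnNge ij.
Qed.

(** Both sides in direction [i] lie on the comb, so only the quotient of two labels in direction [j]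
    remains. *)
Lemma comb_square_label (A : groupType) (rho : 'I_n -> V -> A) q (i j : 'I_n) v :
  comb_labelling i (rho i) (q^~ i) -> comb_labelling j (rho j) (q^~ j) ->
  i < j -> supp_above i v -> square_label rho i j v = q i j v.
Proof.
move=> [ri _] [_ rj] ij iv.
have iv' := supp_above_sub_unit (leqnn i) iv.
have iv'' := supp_above_sub_unit (ltnW ij) iv'.
have e : (v - unit_vec i - unit_vec j + unit_vec i = v - unit_vec j)%R.
  by rewrite addrAC subrK.
have := rj _ _ ij iv''; rewrite e subrK => rE.
by rewrite /square_label !ri // rE invg1 !mul1g mulKg.
Qed.

Lemma square_label_edge_loop (G : groupType) (x : 'I_n -> G) (i j : 'I_n) v :
  square_label (edge_loop x) i j v = [~ x i, x j] ^ (tree_path x v)^-1.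
Proof.
rewrite /square_label /edge_loop !subrK.
rewrite (addrAC _ _ (unit_vec i)) subrK conjgE commgEl conjgE.
by move: (tree_path x) => t; rewrite !invgM !invgK -!mulgA !mulKg.
Qed.

Lemma gmulf_square_label (A G : groupType) (f : UMagmaMorphism.type A G)
    (rho : 'I_n -> V -> A) (rho' : 'I_n -> V -> G) (i j : 'I_n) v :
  (forall u, f (rho i u) = rho' i u) -> (forall u, f (rho j u) = rho' j u) ->
  f (square_label rho i j v) = square_label rho' i j v.
Proof. by move=> fi fj; rewrite /square_label !(gmulfM, gmulfV) !(fi, fj). Qed.

End SquareLabels.

(** * Labels for the surface group and their images in it *)

Section Surface.
Variable g : nat.
Local Open Scope group_scope.
Notation n := (2 * g.+1)%N.
Notation V := {ffun 'I_n -> int}.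
Notation pi := (surface_group g.+1).
Notation x := (@surface_gen g.+1).
Notation A := (free_group (commutator_basis g.+1)).
Notation lambda := (free_lift (val : commutator_basis g.+1 -> pi)).

Lemma surface_relation :
  \prod_(k < g.+1) [~ x (even_index k), x (odd_index k)] = 1.
Proof.
have e : ncl_proj [set surface_relator g.+1] (surface_relator g.+1) = 1.
  apply/esym/ncl_projP; rewrite invg1 mul1g.
  by move=> N [_]; apply.
by rewrite -[RHS]e gmulf_prod; apply: eq_bigr => k _; rewrite gmulfR.
Qed.

(** Indexed by the value of the loop because the basis is a set of group elements; the default 1
    never occurs when [i < j] and [(i, j)] is not [(0, 1)]. *)
Definition loop_gen (i j : 'I_n) (v : V) : A :=
  if insub (square_loop x i j v) is Some s then free_gen s else 1.

Definition pre_label (j : 'I_n) : V -> A := comb_label j (loop_gen^~ j).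

(* For (i, j) = (0, 1), i.e. (x_1, x_2), the value forced by the surface
   relation based at v; only edges in directions x_3, ..., x_2g enter, so there
   is no circularity. *)
Definition square_value (i j : 'I_n) (v : V) : A :=
  if ((i : nat, j : nat) == (0, 1)%N) then
    (\prod_(k < g.+1 | (@ord0 g) < k)
       square_label pre_label (even_index k) (odd_index k) v)^-1
  else loop_gen i j v.

Definition edge_label (j : 'I_n) : V -> A := comb_label j (square_value^~ j).

Lemma lambda_loop_gen (i j : 'I_n) v :
  i < j -> (i : nat, j : nat) <> (0, 1)%N ->
  lambda (loop_gen i j v) = square_loop x i j v.
Proof.
move=> ij ij01; rewrite /loop_gen insubT.
  by apply/mem_set; exists i, j, (fun l => - v l)%R.
by move=> ?; rewrite free_lift_gen.
Qed.

Lemma square_loop_local (i j : 'I_n) (v w : V) :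
  (forall l : 'I_n, i <= l -> v l = w l) ->
  square_loop x i j v = square_loop x i j w.
Proof.
by move=> vw; congr (_ ^ _); apply: eq_bigr => l /vw ->.
Qed.

Lemma edge_labelP (j : 'I_n) : comb_labelling j (edge_label j) (square_value^~ j).
Proof.
apply: comb_labelP => i v w vw; rewrite /square_value.
case: eqP => [[i0 _]|_]; last by rewrite /loop_gen (square_loop_local _ vw).
(* The forced value may depend on all coordinates; locality permits this because [i = 0]. *)
by have -> : v = w by apply/ffunP => l; apply: vw; rewrite i0.
Qed.

Lemma edge_label_gt1 (j : 'I_n) : 1 < j -> edge_label j = pre_label j.
Proof.
move=> j1; rewrite /edge_label /pre_label; congr comb_label.
apply: funext => i; apply: funext => v; rewrite /square_value.
by case: eqP => // -[_ e]; rewrite e in j1.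
Qed.

Lemma square_label_gt0 (k : 'I_g.+1) v : (@ord0 g) < k ->
  square_label pre_label (even_index k) (odd_index k) v =
  square_label edge_label (even_index k) (odd_index k) v.
Proof.
by move=> k0; rewrite /square_label !edge_label_gt1 //=; move: k0 => /=; lia.
Qed.

(** Both sides solve the same labelling problem once their squares agree. Directions other than 1
    come first, their squares being generators; the (0, 1)-squares then agree by the surface
    relation in [pi], solved for its first commutator. *)
Lemma lambda_edge_label (j : 'I_n) v : lambda (edge_label j v) = edge_loop x j v.
Proof.
pose ok (j : 'I_n) := forall v, lambda (edge_label j v) = edge_loop x j v.
suff {v} H (k : 'I_n) : (forall (i : 'I_n) v, i < k -> supp_above i v ->
    lambda (square_value i k v) = square_loop x i k v) -> ok k.
  have ok_ne1 (k : 'I_n) : k <> 1%N :> nat -> ok k.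
    move=> k1; apply: H => i w ik _; rewrite /square_value.
    by case: eqP => [[_ /k1 //]|ne]; rewrite lambda_loop_gen.
  have [j1|/eqP/ok_ne1 //] := eqVneq (j : nat) 1%N.
  apply: H => i w ij iw.
  have i0 : i = 0%N :> nat by rewrite j1 in ij; case: (i : nat) ij.
  rewrite /square_value i0 j1 eqxx gmulfV gmulf_prod square_loopE //.
  rewrite (eq_bigr (fun k =>
    [~ x (even_index k), x (odd_index k)] ^ (tree_path x w)^-1)) => [|k k0].
    rewrite -conjg_prod -conjVg; congr (_ ^ _).
    have := surface_relation; rewrite (@prod_ord_head _ _ ord0) //.
    rewrite (_ : even_index ord0 = i); last exact/val_inj.
    rewrite (_ : odd_index ord0 = j); last exact/val_inj.
    by move=> /(canRL (mulgK _)); rewrite mul1g => ->.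
  rewrite square_label_gt0 // -square_label_edge_loop.
  by apply: gmulf_square_label => u; apply: ok_ne1 => /=; lia.
move=> qE; apply: comb_labelling_unique (edge_loopP x k) qE.
have [r0 rS] := edge_labelP k; split=> [w /r0 ->|i w ik iw]; first exact: gmulf1.
by rewrite rS // gmulfM.
Qed.

Lemma walk_hom : exists F : UMagmaMorphism.type pi (walk A V),
  forall j, F (x j) = (edge_label j, unit_vec j).
Proof.
apply: presented_lift => _ ->; rewrite gmulf_prod.
set f : 'I_n -> walk A V := fun j => (edge_label j, unit_vec j).
rewrite (eq_bigr (fun k => [~ f (even_index k), f (odd_index k)])); last first.
  by move=> k _; rewrite gmulfR /= !free_lift_gen.
have pure v := walk_prod_pure (index_enum 'I_g.+1) v
  (fun k => walk_commg2 (f (even_index k)) (f (odd_index k))).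
apply: walk_eq => [v|]; last by case: (pure 0%R).
have [_ ->] := pure v.
rewrite (eq_bigr (fun k =>
  square_label edge_label (even_index k) (odd_index k) v)); last first.
  by move=> k _; rewrite walk_commg1.
rewrite (@prod_ord_head _ _ ord0) //.
(* For [i = 0] the support condition is vacuous, so the first factor has its forced value at every
   vertex. *)
rewrite (comb_square_label (edge_labelP _) (edge_labelP _)) //.
rewrite /square_value /= (eq_bigr _ (fun k => @square_label_gt0 k v)).
by rewrite mulVg.
Qed.

(** * Holonomy as the inverse of [lambda] *)

Section Holonomy.
Variable F : UMagmaMorphism.type pi (walk A V).
Hypothesis FE : forall j, F (x j) = (edge_label j, unit_vec j).

(** Tree paths between consecutive letters cancel. At [v = 0] and displacement 0 the right side is
    [w], which makes [lambda] onto the commutator subgroup. *)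
Lemma lambda_walk_hom (w : pi) v :
  lambda ((F w).1 v) = tree_path x v * w * (tree_path x (v + (F w).2)%R)^-1.
Proof.
elim/presented_group_ind: w v => [v|y z IHy IHz v|y IHy v|j v].
- by rewrite gmulf1 /= gmulf1 addr0 mulg1 mulgV.
- rewrite gmulfM walkM1 walkM2 free_liftM IHy IHz addrA -!mulgA.
  by rewrite mulKg.
- rewrite gmulfV walkV1 walkV2 free_liftV IHy subrK; move: (tree_path x) => t.
  by rewrite !invgM invgK mulgA.
- by rewrite [F _]FE /= lambda_edge_label.
Qed.

Lemma walk_hom_tree_path v :
  (F (tree_path x v)).1 0%R = 1 /\ (F (tree_path x v)).2 = v.
Proof.
elim/comb_ind: v => [|v j jv]; first by rewrite tree_path0 gmulf1.
have [r0 _] := edge_labelP j.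
rewrite tree_pathS // gmulfM FE /=; split=> -[].
  by move=> -> ->; rewrite add0r r0 // mulg1.
move=> + /addIr e; rewrite e add0r r0 // mulg1 => ->.
by split.
Qed.

Lemma walk_hom_square_loop (i j : 'I_n) v : i < j -> supp_above i v ->
  (F (square_loop x i j v)).1 0%R = square_value i j v /\
  (F (square_loop x i j v)).2 = 0%R.
Proof.
move=> ij iv; rewrite square_loopE // gmulfJ gmulfR gmulfV !FE.
have [] := walk_hom_tree_path v; move: (F _) => t t1 t2.
have := walk_commg2 (edge_label i, unit_vec i) (edge_label j, unit_vec j).
have := walk_commg1 (edge_label i, unit_vec i) (edge_label j, unit_vec j) v.
move: (commg _ _) => c c1 c2; rewrite conjgE invgK /= t1 t2 c2 !add0r addr0 subrr.
rewrite t1 invg1 mulg1 mul1g c1; split=> //.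
exact: (comb_square_label (edge_labelP i) (edge_labelP j)).
Qed.

Lemma walk_hom_basis (s : commutator_basis g.+1) :
  (F (val s)).1 0%R = free_gen s /\ (F (val s)).2 = 0%R.
Proof.
have [i [j [k [ij ij01 sE]]]] := set_mem (valP s).
(* The sign undoes the one in [square_loop]; zeros below [i] put [v] on the comb without changing
   the conjugator. *)
pose v : V := [ffun l : 'I_n => if i <= l then (- k l)%R else 0%R].
have iv : supp_above i v by move=> l li; rewrite ffunE leqNgt li.
have sv : val s = square_loop x i j v.
  rewrite sE /square_loop; congr (_ ^ _); apply: eq_bigr => l il.
  by rewrite ffunE il opprK.
rewrite sv; have [-> ->] := walk_hom_square_loop ij iv.
by split=> //; rewrite /square_value; case: eqP => // _; rewrite /loop_gen -sv valK.
Qed.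

(** With displacement 0, labels read from the origin multiply, so generators suffice; this gives
    injectivity of [lambda]. *)
Lemma walk_hom_lambda (a : A) : (F (lambda a)).1 0%R = a /\ (F (lambda a)).2 = 0%R.
Proof.
elim/free_group_ind: a => [|a b [a1 a2] [b1 b2]|a [a1 a2]|s].
- by rewrite free_lift1 gmulf1.
- by rewrite free_liftM gmulfM walkM1 walkM2 a1 a2 b2 !addr0 b1.
- by rewrite free_liftV gmulfV walkV1 walkV2 a2 subr0 oppr0 a1.
- by rewrite free_lift_gen; apply: walk_hom_basis.
Qed.

Lemma walk_hom_commutator (w : pi) : commutator_subgroup pi w -> (F w).2 = 0%R.
Proof.
move=> cw; apply: (cw [set w | (F w).2 = 0%R]%classic); split.
  split=> [|y z]; first by rewrite /= gmulf1.
  by rewrite /= gmulfF /= => -> ->; rewrite subrr.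
by move=> _ [y [z ->]]; rewrite /= gmulfR walk_commg2.
Qed.

Lemma walk_hom_freely_generated :
  freely_generated (commutator_subgroup pi) (commutator_basis g.+1).
Proof.
split=> [a b ab|].
  by have [<- _] := walk_hom_lambda a; rewrite ab; have [] := walk_hom_lambda b.
apply/seteqP; split=> [_ [a _ <-]|w cw]; last first.
  exists ((F w).1 0%R) => //.
  by rewrite lambda_walk_hom walk_hom_commutator // addr0 tree_path0 mul1g invg1 mulg1.
have cS := commutator_subgroup_subgroup pi.
elim/free_group_ind: a => [|a b ca cb|a ca|s].
- by rewrite free_lift1; case: cS.
- by rewrite free_liftM; apply: (subgroupM cS).
- by rewrite free_liftV; apply: (subgroupV cS).
- rewrite free_lift_gen; have [i [j [k [_ _ ->]]]] := set_mem (valP s).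
  rewrite conjRg => H [_]; apply.
  by do 2!eexists.
Qed.

End Holonomy.

End Surface.

Theorem theorem2 (g : nat) (hg : 1 <= g) :
  freely_generated (commutator_subgroup (surface_group g)) (commutator_basis g).
Proof.
case: g hg => // g _; have [F FE] := walk_hom g.
exact: walk_hom_freely_generated FE.
Qed.
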